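(* Let $(A,m,\eta,\Delta,\varepsilon)$ be a bimonoid in $\mathcal C$ and let $(A,L,\alpha)$ be a Lie-Rinehart monoid in $\mathcal C$ (with underlying monoid $(A,m,\eta)$) such that $\mathbf{WMod}^{\mathcal C}_A(L)$ is a strict monoidal category under $(M;\rho,\gamma)\otimes(M';\rho',\gamma')=(M\otimes M';\rho\boxtimes\rho',\gamma\boxplus\gamma')$ with unit $(I;\varepsilon,\mathbf 0)$. Let $\mathcal H:L\to A$ be a morphism satisfying $$\mathcal H\circ\mu=\alpha\circ(\mathrm{id}_L\otimes\mathcal H)-\alpha\circ(\mathrm{id}_L\otimes\mathcal H)\circ c_{L,L},$$ and let $\mathcal F_{\mathcal H}:\mathbf{WMod}^{\mathcal C}_A(L)\to\mathbf{WMod}^{\mathcal C}_A(L)$ be the endofunctor $(M;\rho,\gamma)\mapsto(M;\rho,\gamma+\rho\circ(\mathcal H\otimes\mathrm{id}_M))$, acting as the identity on morphisms. Then $\mathcal F_{\mathcal H}$ is a strict monoidal functor if and only if $$\Delta\circ\mathcal H=\mathcal H\otimes\eta+\eta\otimes\mathcal H$$ as morphisms $L\to A\otimes A$.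
   Context: Standing setting: $\mathcal C=(\mathcal C,\otimes,I,c)$ is a strict symmetric monoidal category with unit $I$ and symmetric braiding $c_{V,W}:V\otimes W\to W\otimes V$, and it is $\mathbb C$-linear (Hom sets are complex vector spaces; composition and tensor product of morphisms are bilinear). A commutative monoid $(A,m,\eta)$ is an associative unital monoid object with $m\circ c_{A,A}=m$. An $A$-module $(M,\rho)$, $\rho:A\otimes M\to M$, is a left unital associative module. A bimonoid $(A,m,\eta,\Delta,\varepsilon)$ is a monoid and comonoid such that $\Delta$ and $\varepsilon$ are monoid homomorphisms (with $A\otimes A$ a monoid via the braiding). A Lie monoid $(L,\mu)$ is an object $L$ with $\mu:L\otimes L\to L$ such that $\mu=-\mu\circ c_{L,L}$ and $\mu\circ(\mathrm{id}_L\otimes\mu)=\mu\circ(\mu\otimes\mathrm{id}_L)+\mu\circ(\mathrm{id}_L\otimes\mu)\circ(c_{L,L}\otimes\mathrm{id}_L)$. An $L$-module $(M,\gamma)$ is an object $M$ with $\gamma:L\otimes M\to M$ such that $\gamma\circ(\mathrm{id}_L\otimes\gamma)=\gamma\circ(\mu\otimes\mathrm{id}_M)+\gamma\circ(\mathrm{id}_L\otimes\gamma)\circ(c_{L,L}\otimes\mathrm{id}_M)$. A Lie-Rinehart monoid $(A,m,\eta,L,\mu,\alpha,\beta)$ (abbreviated $(A,L,\alpha)$) consists of a commutative monoid $(A,m,\eta)$, a Lie monoid $(L,\mu)$, an $A$-module structure $\beta:A\otimes L\to L$ on $L$, and a morphism $\alpha:L\otimes A\to A$ (the anchor) such that (i)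 $\alpha\circ(\mathrm{id}_L\otimes m)=m\circ(\alpha\otimes\mathrm{id}_A)+m\circ(\mathrm{id}_A\otimes\alpha)\circ(c_{L,A}\otimes\mathrm{id}_A)$; (ii) $\alpha\circ(\beta\otimes\mathrm{id}_A)=m\circ(\mathrm{id}_A\otimes\alpha)$; (iii) $\alpha\circ(\mathrm{id}_L\otimes\alpha)=\alpha\circ(\mu\otimes\mathrm{id}_A)+\alpha\circ(\mathrm{id}_L\otimes\alpha)\circ(c_{L,L}\otimes\mathrm{id}_A)$; (iv) $\mu\circ(\mathrm{id}_L\otimes\beta)=\beta\circ(\alpha\otimes\mathrm{id}_L)+\beta\circ(\mathrm{id}_A\otimes\mu)\circ(c_{L,A}\otimes\mathrm{id}_L)$. A weak module $(M;\rho,\gamma)$ over it is an object $M$ with an $A$-module structure $\rho$ and an $L$-module structure $\gamma$ such that $\gamma\circ(\mathrm{id}_L\otimes\rho)=\rho\circ(\alpha\otimes\mathrm{id}_M)+\rho\circ(\mathrm{id}_A\otimes\gamma)\circ(c_{L,A}\otimes\mathrm{id}_M)$. Morphisms in $\mathbf{WMod}^{\mathcal C}_A(L)$ are the morphisms of $\mathcal C$ commuting with both the $A$-actions and the $L$-actions; on morphisms the tensor product is that of $\mathcal C$. Notation: $\rho\boxtimes\rho'=(\rho\otimes\rho')\circ(\mathrm{id}_A\otimes c_{A,M}\otimes\mathrm{id}_{M'})\circ(\Delta\otimes\mathrm{id}_M\otimes\mathrm{id}_{M'})$ and $\gamma\boxplus\gamma'=\gamma\otimes\mathrm{id}_{M'}+(\mathrm{id}_M\otimes\gamma')\circ(c_{L,M}\otimes\mathrm{id}_{M'})$;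 $\mathbf 0$ is the zero morphism. A functor $F$ between strict monoidal categories is strict monoidal if $F(I)=I$ and $F(V\otimes W)=F(V)\otimes F(W)$ for all objects, with the analogous equalities on morphisms. *)

(* Defs.v *)
From HB Require Import structures.
From mathcomp Require Import all_boot all_order all_algebra.
From mathcomp Require Import boolp reals complex.

Set Implicit Arguments.
Unset Strict Implicit.
Unset Printing Implicit Defensive.

Import GRing.Theory.
Local Open Scope ring_scope.

Record category := Category {
  ob :> Type;
  chom : ob -> ob -> Type;
  idm : forall U, chom U U;
  mcomp : forall U V W, chom V W -> chom U V -> chom U W;
  compA : forall U V W X (f : chom W X) (g : chom V W) (h : chom U V),
    mcomp f (mcomp g h) = mcomp (mcomp f g) h;
  comp1m : forall U V (f : chom U V), mcomp (idm V) f = f;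
  compm1 : forall U V (f : chom U V), mcomp f (idm U) = f
}.

Arguments chom {_} _ _ : simpl never.
Arguments idm {_} U : simpl never.
Arguments mcomp {_ _ _ _} f g : simpl never.

Declare Scope cat_scope.
Notation "f ∘ g" := (mcomp f g) (at level 40, left associativity) : cat_scope.
Local Open Scope cat_scope.

(* The identity of U, viewed as a morphism U -> V along an equality of
   objects.  Strictness of a monoidal category is an equality of objects, and
   Rocq only identifies the chom types over equal objects up to such an idto. *)
Definition idto (C : category) (U V : C) (e : U = V) : chom U V :=
  let: erefl := e in idm U.

(* The class of all morphisms, so that [Arrow f = Arrow g] states the equality
   of two morphisms whose sources and targets are equal but not convertible. *)
Record arrow (C : category) := Arrow {
  src : C;
  tgt : C;
  mor : chom src tgt
}.
Arguments Arrow {C src tgt} mor.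

Record functor (C D : category) := Functor {
  fob :> C -> D;
  fmor : forall U V : C, chom U V -> chom (fob U) (fob V);
  fmor1 : forall U : C, fmor (idm U) = idm (fob U);
  fmorM : forall (U V W : C) (f : chom V W) (g : chom U V),
    fmor (f ∘ g) = fmor f ∘ fmor g
}.

Record monoidal_data (C : category) := MonoidalData {
  tenso : C -> C -> C;
  tensm : forall U U' V V' : C,
    chom U U' -> chom V V' -> chom (tenso U V) (tenso U' V');
  munit : C
}.
Arguments tensm {C} _ {U U' V V'} f g.

Record is_strict_monoidal (C : category) (T : monoidal_data C) : Prop :=
  IsStrictMonoidal {
  tens_id : forall U V : C, tensm T (idm U) (idm V) = idm (tenso T U V);
  tens_comp : forall (U V W U' V' W' : C) (f : chom V W) (g : chom U V)
      (f' : chom V' W') (g' : chom U' V'),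
    tensm T (f ∘ g) (f' ∘ g') = tensm T f f' ∘ tensm T g g';
  tens_obA : forall U V W : C,
    tenso T (tenso T U V) W = tenso T U (tenso T V W);
  tens_ob1l : forall V : C, tenso T (munit T) V = V;
  tens_ob1r : forall V : C, tenso T V (munit T) = V;
  tens_morA : forall (U V W U' V' W' : C)
      (f : chom U U') (g : chom V V') (h : chom W W'),
    Arrow (tensm T (tensm T f g) h) = Arrow (tensm T f (tensm T g h));
  tens_mor1l : forall (V V' : C) (f : chom V V'),
    Arrow (tensm T (idm (munit T)) f) = Arrow f;
  tens_mor1r : forall (V V' : C) (f : chom V V'),
    Arrow (tensm T f (idm (munit T))) = Arrow f
}.

Record is_strict_monoidal_functor (C D : category) (TC : monoidal_data C)
    (TD : monoidal_data D) (F : functor C D) : Prop :=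
  IsStrictMonoidalFunctor {
  smf_unit : F (munit TC) = munit TD;
  smf_ob : forall V W : C, F (tenso TC V W) = tenso TD (F V) (F W);
  smf_mor : forall (V V' W W' : C) (f : chom V V') (g : chom W W'),
    Arrow (fmor F (tensm TC f g)) = Arrow (tensm TD (fmor F f) (fmor F g))
}.

Record linear_category (K : pzRingType) := LinearCategory {
  lob : Type;
  lhom : lob -> lob -> lmodType K;
  lidm : forall U, lhom U U;
  lcomp : forall U V W, lhom V W -> lhom U V -> lhom U W;
  lcompA : forall U V W X (f : lhom W X) (g : lhom V W) (h : lhom U V),
    lcomp f (lcomp g h) = lcomp (lcomp f g) h;
  lcomp1m : forall U V (f : lhom U V), lcomp (lidm V) f = f;
  lcompm1 : forall U V (f : lhom U V), lcomp f (lidm U) = f;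
  lcomp_linearl : forall U V W (a : K) (f f' : lhom V W) (g : lhom U V),
    lcomp (a *: f + f') g = a *: lcomp f g + lcomp f' g;
  lcomp_linearr : forall U V W (a : K) (f : lhom V W) (g g' : lhom U V),
    lcomp f (a *: g + g') = a *: lcomp f g + lcomp f g'
}.

Coercion category_of_linear (K : pzRingType) (C : linear_category K) :
    category :=
  Category (@lcompA K C) (@lcomp1m K C) (@lcompm1 K C).

HB.instance Definition _ (K : pzRingType) (C : linear_category K) (U V : C) :=
  GRing.Lmodule.copy (@chom (category_of_linear C) U V) (@lhom K C U V).

Record ssm_linear_category (K : pzRingType) := SSMLinearCategory {
  ssm_cat :> linear_category K;
  tensor : monoidal_data ssm_cat;
  tensor_strict : is_strict_monoidal tensor;
  tensor_linearl : forall (U U' V V' : ssm_cat) (a : K)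
      (f f' : chom U U') (g : chom V V'),
    tensm tensor (a *: f + f') g = a *: tensm tensor f g + tensm tensor f' g;
  tensor_linearr : forall (U U' V V' : ssm_cat) (a : K)
      (f : chom U U') (g g' : chom V V'),
    tensm tensor f (a *: g + g') = a *: tensm tensor f g + tensm tensor f g';
  braid : forall V W : ssm_cat, chom (tenso tensor V W) (tenso tensor W V);
  braid_nat : forall (V V' W W' : ssm_cat) (f : chom V V') (g : chom W W'),
    braid V' W' ∘ tensm tensor f g = tensm tensor g f ∘ braid V W;
  braid_sym : forall V W : ssm_cat,
    braid W V ∘ braid V W = idm (tenso tensor V W);
  (* c_{U, V ⊗ W} = (id_V ⊗ c_{U,W}) ∘ (c_{U,V} ⊗ id_W) *)
  braid_hexagon : forall U V W : ssm_cat,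
    let asc X Y Z := idto (tens_obA tensor_strict X Y Z) in
    asc V W U ∘ braid U (tenso tensor V W) ∘ asc U V W =
    tensm tensor (idm V) (braid U W) ∘ asc V U W
      ∘ tensm tensor (braid U V) (idm W)
}.

Notation "U ⊗ V" := (tenso (tensor _) U V)
  (at level 39, left associativity) : cat_scope.
Notation "f ⊗ₘ g" := (tensm (tensor _) f g)
  (at level 39, left associativity) : cat_scope.

Section Structures.
Variables (K : pzRingType) (C : ssm_linear_category K).

Definition uob : C := munit (tensor C).

(* In a strict category these are identities; they only reconcile the types of
   the composites below. *)
Definition asc (U V W : C) : chom (U ⊗ V ⊗ W) (U ⊗ (V ⊗ W)) :=
  idto (tens_obA (tensor_strict C) U V W).
Definition asci (U V W : C) : chom (U ⊗ (V ⊗ W)) (U ⊗ V ⊗ W) :=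
  idto (esym (tens_obA (tensor_strict C) U V W)).
Definition lunit (V : C) : chom (uob ⊗ V) V :=
  idto (tens_ob1l (tensor_strict C) V).
Definition luniti (V : C) : chom V (uob ⊗ V) :=
  idto (esym (tens_ob1l (tensor_strict C) V)).
Definition runit (V : C) : chom (V ⊗ uob) V :=
  idto (tens_ob1r (tensor_strict C) V).
Definition runiti (V : C) : chom V (V ⊗ uob) :=
  idto (esym (tens_ob1r (tensor_strict C) V)).

(* id_U ⊗ c_{V,W} ⊗ id_X *)
Definition mid (U V W X : C) :
    chom ((U ⊗ V) ⊗ (W ⊗ X)) ((U ⊗ W) ⊗ (V ⊗ X)) :=
  asci U W (V ⊗ X)
    ∘ (idm U ⊗ₘ (asc W V X ∘ (braid V W ⊗ₘ idm X) ∘ asci V W X))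
    ∘ asc U V (W ⊗ X).

Record is_monoid (A : C) (m : chom (A ⊗ A) A) (eta : chom uob A) : Prop :=
  IsMonoid {
  monoidA : m ∘ (m ⊗ₘ idm A) = m ∘ (idm A ⊗ₘ m) ∘ asc A A A;
  monoid1l : m ∘ (eta ⊗ₘ idm A) = lunit A;
  monoid1r : m ∘ (idm A ⊗ₘ eta) = runit A
}.

Record is_comm_monoid (A : C) (m : chom (A ⊗ A) A) (eta : chom uob A) : Prop :=
  IsCommMonoid {
  comm_monoid_monoid :> is_monoid m eta;
  monoidC : m ∘ braid A A = m
}.

Record is_comonoid (A : C) (Delta : chom A (A ⊗ A)) (eps : chom A uob) : Prop :=
  IsComonoid {
  comonoidA :
    asc A A A ∘ (Delta ⊗ₘ idm A) ∘ Delta = (idm A ⊗ₘ Delta) ∘ Delta;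
  comonoid1l : lunit A ∘ (eps ⊗ₘ idm A) ∘ Delta = idm A;
  comonoid1r : runit A ∘ (idm A ⊗ₘ eps) ∘ Delta = idm A
}.

Record is_bimonoid (A : C) (m : chom (A ⊗ A) A) (eta : chom uob A)
    (Delta : chom A (A ⊗ A)) (eps : chom A uob) : Prop := IsBimonoid {
  bimonoid_monoid :> is_monoid m eta;
  bimonoid_comonoid :> is_comonoid Delta eps;
  comulM : Delta ∘ m = (m ⊗ₘ m) ∘ mid A A A A ∘ (Delta ⊗ₘ Delta);
  comul1 : Delta ∘ eta = (eta ⊗ₘ eta) ∘ luniti uob;
  counitM : eps ∘ m = lunit uob ∘ (eps ⊗ₘ eps);
  counit1 : eps ∘ eta = idm uob
}.

Record is_module (A : C) (m : chom (A ⊗ A) A) (eta : chom uob A)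
    (M : C) (rho : chom (A ⊗ M) M) : Prop := IsModule {
  moduleA : rho ∘ (m ⊗ₘ idm M) = rho ∘ (idm A ⊗ₘ rho) ∘ asc A A M;
  module1 : rho ∘ (eta ⊗ₘ idm M) = lunit M
}.

Record is_lie_monoid (L : C) (mu : chom (L ⊗ L) L) : Prop := IsLieMonoid {
  lie_antisym : mu = - (mu ∘ braid L L);
  lie_jacobi : mu ∘ (idm L ⊗ₘ mu) ∘ asc L L L =
    mu ∘ (mu ⊗ₘ idm L)
    + mu ∘ (idm L ⊗ₘ mu) ∘ asc L L L ∘ (braid L L ⊗ₘ idm L)
}.

Definition is_lie_module (L : C) (mu : chom (L ⊗ L) L)
    (M : C) (gamma : chom (L ⊗ M) M) : Prop :=
  gamma ∘ (idm L ⊗ₘ gamma) ∘ asc L L M =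
    gamma ∘ (mu ⊗ₘ idm M)
    + gamma ∘ (idm L ⊗ₘ gamma) ∘ asc L L M ∘ (braid L L ⊗ₘ idm M).

Record lie_rinehart := LieRinehart {
  lrA : C;
  lr_mul : chom (lrA ⊗ lrA) lrA;
  lr_unit : chom uob lrA;
  lrL : C;
  lr_brk : chom (lrL ⊗ lrL) lrL;
  lr_anchor : chom (lrL ⊗ lrA) lrA;
  lr_act : chom (lrA ⊗ lrL) lrL;
  lr_monoid : is_comm_monoid lr_mul lr_unit;
  lr_lie : is_lie_monoid lr_brk;
  lr_module : is_module lr_mul lr_unit lr_act;
  lr_derivation :
    lr_anchor ∘ (idm lrL ⊗ₘ lr_mul) ∘ asc lrL lrA lrA =
    lr_mul ∘ (lr_anchor ⊗ₘ idm lrA)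
    + lr_mul ∘ (idm lrA ⊗ₘ lr_anchor) ∘ asc lrA lrL lrA
        ∘ (braid lrL lrA ⊗ₘ idm lrA);
  lr_anchor_linear :
    lr_anchor ∘ (lr_act ⊗ₘ idm lrA) =
    lr_mul ∘ (idm lrA ⊗ₘ lr_anchor) ∘ asc lrA lrL lrA;
  lr_anchor_lie : is_lie_module lr_brk lr_anchor;
  lr_leibniz :
    lr_brk ∘ (idm lrL ⊗ₘ lr_act) ∘ asc lrL lrA lrL =
    lr_act ∘ (lr_anchor ⊗ₘ idm lrL)
    + lr_act ∘ (idm lrA ⊗ₘ lr_brk) ∘ asc lrA lrL lrL
        ∘ (braid lrL lrA ⊗ₘ idm lrL)
}.

Variable X : lie_rinehart.
Local Notation A := (lrA X).
Local Notation L := (lrL X).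
Local Notation m := (lr_mul X).
Local Notation eta := (lr_unit X).
Local Notation mu := (lr_brk X).
Local Notation alpha := (lr_anchor X).

Record is_weak_module (M : C) (rho : chom (A ⊗ M) M) (gamma : chom (L ⊗ M) M) :
    Prop := IsWeakModule {
  weak_module_module : is_module m eta rho;
  weak_module_lie_module : is_lie_module mu gamma;
  weak_module_compat :
    gamma ∘ (idm L ⊗ₘ rho) ∘ asc L A M =
    rho ∘ (alpha ⊗ₘ idm M)
    + rho ∘ (idm A ⊗ₘ gamma) ∘ asc A L M ∘ (braid L A ⊗ₘ idm M)
}.

Record weak_module := WeakModule {
  wm_ob :> C;
  wm_act : chom (A ⊗ wm_ob) wm_ob;
  wm_lie : chom (L ⊗ wm_ob) wm_ob;
  wm_axioms : is_weak_module wm_act wm_lie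
}.

Definition is_wm_hom (M N : weak_module) (f : chom (wm_ob M) (wm_ob N)) : Prop :=
  f ∘ wm_act M = wm_act N ∘ (idm A ⊗ₘ f) /\
  f ∘ wm_lie M = wm_lie N ∘ (idm L ⊗ₘ f).

Definition wm_hom (M N : weak_module) : Type :=
  {f : chom (wm_ob M) (wm_ob N) | is_wm_hom f}.

Lemma wm_hom_inj (M N : weak_module) (f g : wm_hom M N) :
  sval f = sval g -> f = g.
Proof. exact: eq_sig_hprop (fun _ => @Prop_irrelevance _) _ _. Qed.

Local Notation TS := (tensor_strict C).

Lemma comp_tens (U V W U' V' W' : C) (f : chom V W) (g : chom U V)
  (f' : chom V' W') (g' : chom U' V') :
  (f ⊗ₘ f') ∘ (g ⊗ₘ g') = (f ∘ g) ⊗ₘ (f' ∘ g').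
Proof. by rewrite (tens_comp TS). Qed.

Lemma tens1 (U V : C) : idm U ⊗ₘ idm V = idm (U ⊗ V).
Proof. exact: tens_id TS U V. Qed.

Lemma is_wm_hom_id (M : weak_module) : is_wm_hom (idm (wm_ob M)).
Proof. by split; rewrite tens1 comp1m compm1. Qed.

Lemma is_wm_hom_comp (M N P : weak_module) (f : wm_hom N P) (g : wm_hom M N) :
  is_wm_hom (sval f ∘ sval g).
Proof.
case: f g => [f [fa fl]] [g [ga gl]]; split => /=.
- by rewrite -compA ga compA fa -compA comp_tens comp1m.
- by rewrite -compA gl compA fl -compA comp_tens comp1m.
Qed.

Definition wm_id (M : weak_module) : wm_hom M M := exist _ _ (is_wm_hom_id M).

Definition wm_comp (M N P : weak_module) (f : wm_hom N P) (g : wm_hom M N) :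
    wm_hom M P :=
  exist _ _ (is_wm_hom_comp f g).

Lemma wm_compA (M N P Q : weak_module) (f : wm_hom P Q) (g : wm_hom N P)
  (h : wm_hom M N) : wm_comp f (wm_comp g h) = wm_comp (wm_comp f g) h.
Proof. by apply: wm_hom_inj => /=; rewrite compA. Qed.

Lemma wm_comp1m (M N : weak_module) (f : wm_hom M N) : wm_comp (wm_id N) f = f.
Proof. by apply: wm_hom_inj => /=; rewrite comp1m. Qed.

Lemma wm_compm1 (M N : weak_module) (f : wm_hom M N) : wm_comp f (wm_id M) = f.
Proof. by apply: wm_hom_inj => /=; rewrite compm1. Qed.

Definition WMod : category := Category wm_compA wm_comp1m wm_compm1.

Lemma idto_natP (x y : arrow C) : x = y ->
  exists (e : src x = src y) (e' : tgt x = tgt y),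
    idto e' ∘ mor x = mor y ∘ idto e.
Proof.
by move=> ->; exists erefl, erefl; rewrite /= (@comp1m C) (@compm1 C).
Qed.

Lemma asc_nat (U V W U' V' W' : C) (f : chom U U') (g : chom V V')
  (h : chom W W') :
  asc U' V' W' ∘ (f ⊗ₘ g ⊗ₘ h) = f ⊗ₘ (g ⊗ₘ h) ∘ asc U V W.
Proof.
have [e [e' E]] := idto_natP (tens_morA TS f g h).
by rewrite /asc (Prop_irrelevance (tens_obA _ _ _ _) e)
  (Prop_irrelevance (tens_obA _ _ _ _) e').
Qed.

Lemma idtoK (U V : C) (e : U = V) : idto (esym e) ∘ idto e = idm U.
Proof. by case: V / e; rewrite /= (@comp1m C). Qed.

Lemma idtoVK (U V : C) (e : U = V) : idto e ∘ idto (esym e) = idm V.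
Proof. by case: V / e; rewrite /= (@comp1m C). Qed.

Lemma asci_nat (U V W U' V' W' : C) (f : chom U U') (g : chom V V')
  (h : chom W W') :
  asci U' V' W' ∘ (f ⊗ₘ (g ⊗ₘ h)) = f ⊗ₘ g ⊗ₘ h ∘ asci U V W.
Proof.
rewrite -[LHS]compm1 -[in LHS](idtoVK (tens_obA TS U V W)) -!compA.
by rewrite (compA (_ ⊗ₘ _)) -asc_nat -!compA (compA (asci _ _ _)) idtoK comp1m.
Qed.

Lemma mid_nat (U V W Y U' V' W' Y' : C) (f : chom U U') (g : chom V V')
  (h : chom W W') (k : chom Y Y') :
  mid U' V' W' Y' ∘ (f ⊗ₘ g ⊗ₘ (h ⊗ₘ k)) =
  f ⊗ₘ h ⊗ₘ (g ⊗ₘ k) ∘ mid U V W Y.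
Proof.
rewrite /mid -compA asc_nat !compA -asci_nat; congr mcomp.
rewrite -!compA; congr mcomp; rewrite !comp_tens comp1m compm1.
congr tensm; rewrite -!compA asci_nat (compA (_ ⊗ₘ _)) comp_tens braid_nat.
by rewrite comp1m (compA (_ ⊗ₘ _)) -asc_nat -!compA (compA (_ ⊗ₘ _))
  comp_tens compm1.
Qed.

Lemma comp_addl (U V W : C) (f f' : chom V W) (g : chom U V) :
  (f + f') ∘ g = f ∘ g + f' ∘ g.
Proof. by have := lcomp_linearl 1 f f' g; rewrite !scale1r. Qed.

Lemma comp_addr (U V W : C) (f : chom V W) (g g' : chom U V) :
  f ∘ (g + g') = f ∘ g + f ∘ g'.
Proof. by have := lcomp_linearr 1 f g g'; rewrite !scale1r. Qed.

Lemma tens_addl (U U' V V' : C) (f f' : chom U U') (g : chom V V') :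
  (f + f') ⊗ₘ g = f ⊗ₘ g + f' ⊗ₘ g.
Proof. by have := tensor_linearl 1 f f' g; rewrite !scale1r. Qed.

Lemma tens_addr (U U' V V' : C) (f : chom U U') (g g' : chom V V') :
  f ⊗ₘ (g + g') = f ⊗ₘ g + f ⊗ₘ g'.
Proof. by have := tensor_linearr 1 f g g'; rewrite !scale1r. Qed.

Section Tensor.
Variables (Delta : chom A (A ⊗ A)) (eps : chom A uob).

Definition boxtimes (M M' : C) (rho : chom (A ⊗ M) M) (rho' : chom (A ⊗ M') M') :
    chom (A ⊗ (M ⊗ M')) (M ⊗ M') :=
  (rho ⊗ₘ rho') ∘ mid A A M M' ∘ (Delta ⊗ₘ idm (M ⊗ M')).

Definition boxplus (M M' : C) (gamma : chom (L ⊗ M) M)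
    (gamma' : chom (L ⊗ M') M') : chom (L ⊗ (M ⊗ M')) (M ⊗ M') :=
  (gamma ⊗ₘ idm M') ∘ asci L M M'
  + (idm M ⊗ₘ gamma') ∘ asc M L M' ∘ (braid L M ⊗ₘ idm M') ∘ asci L M M'.

Record wm_tensor_closed : Prop := WMTensorClosed {
  wm_tensor_axioms : forall M M' : weak_module,
    is_weak_module (boxtimes (wm_act M) (wm_act M'))
                   (boxplus (wm_lie M) (wm_lie M'));
  wm_unit_axioms : is_weak_module (M := uob) (eps ∘ runit A) 0
}.

Hypothesis closed : wm_tensor_closed.

Definition wm_tensor (M M' : weak_module) : weak_module :=
  WeakModule (wm_tensor_axioms closed M M').

Definition wm_unit : weak_module := WeakModule (wm_unit_axioms closed).

Lemma is_wm_hom_tensor (M N M' N' : weak_module)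
    (f : wm_hom M N) (f' : wm_hom M' N') :
  @is_wm_hom (wm_tensor M M') (wm_tensor N N') (sval f ⊗ₘ sval f').
Proof.
split => /=.
- rewrite /boxtimes; have := mid_nat (idm A) (idm A) (sval f) (sval f').
  move: (mid A A M M') (mid A A N N') => s t; rewrite tens1 => E.
  rewrite -!compA comp_tens comp1m compm1 !compA comp_tens.
  rewrite (proj1 (svalP f)) (proj1 (svalP f')) -comp_tens -(compA _ _ s) -E.
  by rewrite -!compA comp_tens comp1m compm1.
- case: f f' => [f [_ fl]] [f' [_ fl']] /=.
  rewrite /boxplus comp_addl comp_addr.
  rewrite -!compA asci_nat !compA !comp_tens comp1m compm1 fl fl'.
  congr (_ + _); rewrite compm1 -!compA (compA (braid _ _ ⊗ₘ _)) comp_tens.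
  rewrite comp1m braid_nat -[f' in RHS]compm1 -comp_tens !compA.
  rewrite -(compA _ (asc (wm_ob N) L (wm_ob N'))) asc_nat !compA comp_tens.
  by rewrite comp1m.
Qed.

Definition wm_tensor_hom (M N M' N' : WMod) (f : chom M N) (f' : chom M' N') :
    wm_hom (wm_tensor M M') (wm_tensor N N') :=
  exist _ _ (is_wm_hom_tensor f f').

Definition WMod_monoidal : monoidal_data WMod :=
  @MonoidalData WMod wm_tensor wm_tensor_hom wm_unit.

End Tensor.

Section ModuleActions.
Variables (M : C) (r : chom (A ⊗ M) M).
Hypothesis rM : is_module m eta r.

Lemma act_left (B : C) (f : chom B A) :
  r ∘ (f ⊗ₘ idm M) ∘ (idm B ⊗ₘ r) ∘ asc B A M =
  r ∘ ((m ∘ (f ⊗ₘ idm A)) ⊗ₘ idm M).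
Proof.
have -> : r ∘ (f ⊗ₘ idm M) ∘ (idm B ⊗ₘ r) =
          r ∘ (idm A ⊗ₘ r) ∘ (f ⊗ₘ (idm A ⊗ₘ idm M)).
  by rewrite -!compA !comp_tens !comp1m !compm1 tens1 compm1.
rewrite -compA -asc_nat compA -(moduleA rM) -compA comp_tens.
by rewrite comp1m.
Qed.

Lemma act_right (B : C) (f : chom B A) :
  r ∘ (idm A ⊗ₘ (r ∘ (f ⊗ₘ idm M))) ∘ asc A B M =
  r ∘ ((m ∘ (idm A ⊗ₘ f)) ⊗ₘ idm M).
Proof.
rewrite -[idm A in LHS]comp1m -comp_tens -!compA -asc_nat !compA.
by rewrite -(moduleA rM) -compA comp_tens comp1m.
Qed.

End ModuleActions.

Section Twist.
Variable H : chom L A.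

Definition twist (M : C) (rho : chom (A ⊗ M) M) (gamma : chom (L ⊗ M) M) :
    chom (L ⊗ M) M :=
  gamma + rho ∘ (H ⊗ₘ idm M).

Hypothesis H_brk : H ∘ mu =
  alpha ∘ (idm L ⊗ₘ H) - alpha ∘ (idm L ⊗ₘ H) ∘ braid L L.

Lemma twist_compat (M : weak_module) :
  twist (wm_act M) (wm_lie M) ∘ (idm L ⊗ₘ wm_act M) ∘ asc L A M =
  wm_act M ∘ (alpha ⊗ₘ idm M)
  + wm_act M ∘ (idm A ⊗ₘ twist (wm_act M) (wm_lie M)) ∘ asc A L M
      ∘ (braid L A ⊗ₘ idm M).
Proof.
case: M => M r g [rM _ gr] /=.
rewrite /twist tens_addr !(comp_addl, comp_addr) gr -addrA; congr (_ + (_ + _)).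
rewrite (act_left rM H) (act_right rM H) -compA comp_tens comp1m.
by rewrite -[m in LHS](monoidC (lr_monoid X)) -!compA braid_nat.
Qed.

Lemma twist_lie (M : weak_module) :
  is_lie_module mu (twist (wm_act M) (wm_lie M)).
Proof.
case: M => M r g [rM gM gr] /=.
have gH : g ∘ (idm L ⊗ₘ (r ∘ (H ⊗ₘ idm M))) ∘ asc L L M =
    r ∘ ((alpha ∘ (idm L ⊗ₘ H)) ⊗ₘ idm M)
    + r ∘ (H ⊗ₘ idm M) ∘ (idm L ⊗ₘ g) ∘ asc L L M ∘ (braid L L ⊗ₘ idm M).
  rewrite -[idm L in LHS]comp1m -comp_tens -!compA -asc_nat.
  rewrite (compA _ (asc _ _ _)) compA (compA g) gr comp_addl.
  rewrite -!compA !comp_tens !comp1m; congr (_ + _); congr (r ∘ _).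
  rewrite braid_nat -[idm M in LHS]comp1m -comp_tens (compA (asc _ _ _)).
  by rewrite asc_nat tens1 !compA !comp_tens !comp1m !compm1.
have HH : r ∘ (H ⊗ₘ idm M) ∘ (idm L ⊗ₘ (r ∘ (H ⊗ₘ idm M))) ∘ asc L L M =
    r ∘ ((m ∘ (H ⊗ₘ H)) ⊗ₘ idm M).
  rewrite -[idm L in LHS]comp1m -comp_tens -!compA -asc_nat.
  rewrite (compA _ (asc _ _ _)) !compA (act_left rM H) -compA comp_tens compm1.
  by rewrite -compA comp_tens comp1m compm1.
have HHC : r ∘ ((m ∘ (H ⊗ₘ H)) ⊗ₘ idm M) ∘ (braid L L ⊗ₘ idm M) =
    r ∘ ((m ∘ (H ⊗ₘ H)) ⊗ₘ idm M).
  rewrite -compA comp_tens comp1m -(compA m) -braid_nat (compA m).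
  by rewrite (monoidC (lr_monoid X)).
have Hmu : r ∘ ((alpha ∘ (idm L ⊗ₘ H)) ⊗ₘ idm M) =
    r ∘ (H ⊗ₘ idm M) ∘ (mu ⊗ₘ idm M)
    + r ∘ ((alpha ∘ (idm L ⊗ₘ H)) ⊗ₘ idm M) ∘ (braid L L ⊗ₘ idm M).
  rewrite -!compA !comp_tens !comp1m H_brk -comp_addr -tens_addl.
  by rewrite subrK.
have braidK (Z : C) (f : chom (L ⊗ L ⊗ M) Z) :
    f ∘ (braid L L ⊗ₘ idm M) ∘ (braid L L ⊗ₘ idm M) = f.
  by rewrite -compA comp_tens braid_sym comp1m tens1 compm1.
rewrite /is_lie_module /twist tens_addr !(comp_addl, comp_addr).
rewrite [in LHS]gM gH HH !comp_addl braidK HHC {1}Hmu.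
by rewrite [LHS](AC (2*3*2)%AC ((1*3)*((2*(4*6))*(5*7)))%AC).
Qed.

Lemma is_weak_module_twist (M : weak_module) :
  is_weak_module (wm_act M) (twist (wm_act M) (wm_lie M)).
Proof.
split; [exact: weak_module_module (wm_axioms M) | exact: twist_lie |].
exact: twist_compat.
Qed.

Definition wm_twist (M : WMod) : WMod := WeakModule (is_weak_module_twist M).

Lemma is_wm_hom_twist (M N : WMod) (f : chom M N) :
  @is_wm_hom (wm_twist M) (wm_twist N) (sval f).
Proof.
case: f => f [fa fl]; split=> //=.
rewrite /twist comp_addr comp_addl fl; congr (_ + _).
by rewrite compA fa -!compA !comp_tens !comp1m !compm1.
Qed.

Definition wm_twist_hom (M N : WMod) (f : chom M N) :
    chom (wm_twist M) (wm_twist N) :=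
  exist _ (sval f) (is_wm_hom_twist f).

Lemma wm_twist_id (M : WMod) : wm_twist_hom (idm M) = idm (wm_twist M).
Proof. exact: wm_hom_inj. Qed.

Lemma wm_twist_comp (M N P : WMod) (f : chom N P) (g : chom M N) :
  wm_twist_hom (f ∘ g) = wm_twist_hom f ∘ wm_twist_hom g.
Proof. exact: wm_hom_inj. Qed.

Definition twist_functor : functor WMod WMod :=
  Functor wm_twist_id wm_twist_comp.

End Twist.

End Structures.

(* Main.v *)
(* A map f : B -> A ⊗ A makes B act on the tensor product of two A-modules
   ([act2]), and boxtimes is the action of Delta.  The functor respects tensor
   products iff Delta ∘ H and the primitive map H ⊗ eta + eta ⊗ H act equally on
   all tensor products of weak modules.  The regular weak module (A; m, alpha)
   detects equality of such maps, by evaluation at the unit eta ⊗ eta.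
   Conversely, counitality applied to a primitive Delta ∘ H gives eps ∘ H = 0,
   so the unit object is preserved as well. *)

Require Import Defs.
From mathcomp Require Import all_boot all_order all_algebra.
From mathcomp Require Import boolp reals complex.

(* compA is the associativity of composition in a category, not ssrfun.compA. *)
Import Defs.

Set Implicit Arguments.
Unset Strict Implicit.
Unset Printing Implicit Defensive.

Import GRing.Theory.
Local Open Scope ring_scope.
Local Open Scope cat_scope.

(** * Transport along equalities of objects *)

Lemma idto_comp (C : category) (U V W : C) (e : U = V) (e' : V = W) :
  idto e' ∘ idto e = idto (etrans e e').
Proof. by case: W / e'; rewrite comp1m. Qed.

Lemma idto_irr (C : category) (U V : C) (e e' : U = V) : idto e = idto e'.
Proof. by rewrite (Prop_irrelevance e e'). Qed.

Lemma comp_idto2 (C : category) (U V W Z : C) (f : chom W Z) (e : U = V)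
    (e' : V = W) :
  f ∘ idto e' ∘ idto e = f ∘ idto (etrans e e').
Proof. by rewrite -compA idto_comp. Qed.

Lemma idto1 (C : category) (U : C) : idto (erefl U) = idm U.
Proof. by []. Qed.

(** * Strictness isomorphisms and the braiding with the unit object *)

Section Coherence.
Variables (K : pzRingType) (C : ssm_linear_category K).
Local Notation TS := (tensor_strict C).

Lemma Arrow_inj (U V : C) (f g : chom U V) : Arrow f = Arrow g -> f = g.
Proof.
move=> /idto_natP[e [e' /=]].
by rewrite (idto_irr e erefl) (idto_irr e' erefl) comp1m compm1.
Qed.

Lemma comp0l (U V W : C) (g : chom U V) : (0 : chom V W) ∘ g = 0.
Proof. by apply: (addrI (0 ∘ g)); rewrite -comp_addl !addr0. Qed.

Lemma comp0r (U V W : C) (f : chom V W) : f ∘ (0 : chom U V) = 0.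
Proof. by apply: (addrI (f ∘ 0)); rewrite -comp_addr !addr0. Qed.

Lemma tens_idto (U U' V V' : C) (e : U = U') (e' : V = V') :
  idto e ⊗ₘ idto e' = idto (f_equal2 (tenso (tensor C)) e e').
Proof. by case: _ / e; case: _ / e'; rewrite tens1; exact: (idto_irr erefl). Qed.

Lemma lunit_nat (U V : C) (f : chom U V) :
  lunit V ∘ (idm (uob C) ⊗ₘ f) = f ∘ lunit U.
Proof.
have [e [e' /= E]] := idto_natP (tens_mor1l TS f).
by rewrite /lunit (idto_irr _ e) (idto_irr _ e').
Qed.

Lemma runit_nat (U V : C) (f : chom U V) :
  runit V ∘ (f ⊗ₘ idm (uob C)) = f ∘ runit U.
Proof.
have [e [e' /= E]] := idto_natP (tens_mor1r TS f).
by rewrite /runit (idto_irr _ e) (idto_irr _ e').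
Qed.

Lemma runiti_nat (U V : C) (f : chom U V) :
  (f ⊗ₘ idm (uob C)) ∘ runiti U = runiti V ∘ f.
Proof.
rewrite -[LHS]comp1m -(idtoK (tens_ob1r TS V)) -!compA.
by rewrite (compA _ (f ⊗ₘ _)) runit_nat -compA idtoVK compm1.
Qed.

(** Composites and tensor products of [idto]s collapse to a single [idto], and parallel [idto]s
    agree by proof irrelevance: this is all the coherence that a strict category needs. *)
Ltac idto_norm :=
  rewrite /asc /asci /lunit /luniti /runit /runiti -?idto1;
  rewrite ?(tens_idto, compA, idto_comp, comp_idto2).
Ltac coherence := idto_norm; exact: idto_irr.

Lemma tens_unitl (U V : C) (f : chom U V) :
  idm (uob C) ⊗ₘ f = luniti V ∘ f ∘ lunit U.
Proof. by rewrite -compA -lunit_nat compA idtoK comp1m. Qed.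

Lemma tens_unitr (U V : C) (f : chom U V) :
  f ⊗ₘ idm (uob C) = runiti V ∘ f ∘ runit U.
Proof. by rewrite -compA -runit_nat compA idtoK comp1m. Qed.

(** The form in which the hexagon reaches [braid_unitr]. With [V] and [W] generic, the outer
    equalities can be eliminated or cancelled, while the inner one is a loop and hence trivial. *)
Lemma idto_idem (U V W : C) (b : chom U U) (e1 e1' : U = W) (e2 e2' : V = U)
    (e : U = U) :
  idto e1 ∘ b ∘ idto e2 = idto e1' ∘ b ∘ idto e ∘ b ∘ idto e2' -> b = b ∘ b.
Proof.
case: W / e1 e1' => e1'; rewrite (idto_irr e1' erefl) (idto_irr e erefl).
rewrite (idto_irr e2' e2) !idto1 !comp1m compm1 => E.
by rewrite -[LHS]compm1 -(idtoVK e2) compA E -compA idtoVK compm1.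
Qed.

(* The hexagon at V = W = I makes [lunit U ∘ c_{U,I}], up to the identification
   of U ⊗ I with U, an idempotent; being invertible it is the identity. *)
Lemma braid_unitr (U : C) : braid U (uob C) = luniti U ∘ runit U.
Proof.
pose I := uob C; pose b : chom U U := lunit U ∘ braid U I ∘ runiti U.
have bE : braid U I = luniti U ∘ b ∘ runit U.
  by rewrite /b !compA idtoK comp1m -compA idtoK compm1.
have bb : b = b ∘ b.
  have /= := braid_hexagon U I I.
  (* Naturality along [luniti I], since [I ⊗ I] and [I] are equal but not convertible. *)
  have -> : braid U (I ⊗ I) =
      (luniti I ⊗ₘ idm U) ∘ braid U I ∘ (idm U ⊗ₘ lunit I).
    by rewrite -braid_nat -compA comp_tens idtoK comp1m tens1 compm1.
  clearbody b.
  rewrite tens_unitl tens_unitr bE; idto_norm; exact: idto_idem.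
have bi : b ∘ (runit U ∘ braid I U ∘ luniti U) = idm U.
  rewrite /b !compA -(compA _ (runiti U)) idtoK compm1.
  by rewrite -(compA _ (braid U I)) braid_sym compm1 idtoVK.
rewrite bE; suff -> : b = idm U by rewrite compm1.
by rewrite -[LHS]compm1 -[in LHS]bi compA -bb.
Qed.

Lemma braid_unitl (U : C) : braid (uob C) U = runiti U ∘ lunit U.
Proof.
have := braid_sym (uob C) U; rewrite braid_unitr => E.
rewrite -[LHS]comp1m -(idtoK (tens_ob1r TS U)) -/(runit U) -/(runiti U).
rewrite -!compA; congr mcomp.
rewrite -[LHS]comp1m -(idtoVK (tens_ob1l TS U)) -/(lunit U) -/(luniti U).
by rewrite -!compA (compA (luniti U)) E compm1.
Qed.

(** This and [mid_unit1] turn [mid] into the structural maps of the first and second summand of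
    [boxplus]. *)
Lemma mid_unit2 (U V W : C) :
  (idm (U ⊗ V) ⊗ₘ lunit W) ∘ mid U (uob C) V W ∘ (runiti U ⊗ₘ idm (V ⊗ W)) =
  asci U V W.
Proof. rewrite /mid braid_unitl; coherence. Qed.

Lemma mid_unit1 (U V W : C) :
  (lunit V ⊗ₘ idm (U ⊗ W)) ∘ mid (uob C) U V W ∘ (luniti U ⊗ₘ idm (V ⊗ W)) =
  asc V U W ∘ (braid U V ⊗ₘ idm W) ∘ asci U V W.
Proof.
rewrite /mid tens_unitl; idto_norm.
by congr (_ ∘ _ ∘ _); exact: idto_irr.
Qed.

Lemma mid_units (U V : C) :
  (runit U ⊗ₘ runit V) ∘ mid U V (uob C) (uob C)
    ∘ (idm (U ⊗ V) ⊗ₘ luniti (uob C)) = runit (U ⊗ V).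
Proof. rewrite /mid braid_unitr; coherence. Qed.

End Coherence.

(** * Actions on tensor products through A ⊗ A *)

Section TwoSidedAction.
Variables (K : pzRingType) (C : ssm_linear_category K).
Variable X : lie_rinehart C.
Local Notation A := (lrA X).
Local Notation L := (lrL X).
Local Notation m := (lr_mul X).
Local Notation eta := (lr_unit X).

Definition act2 (B M N : C) (rho : chom (A ⊗ M) M) (rho' : chom (A ⊗ N) N)
    (f : chom B (A ⊗ A)) : chom (B ⊗ (M ⊗ N)) (M ⊗ N) :=
  (rho ⊗ₘ rho') ∘ mid A A M N ∘ (f ⊗ₘ idm (M ⊗ N)).

Lemma act2_comp (B B' M N : C) (rho : chom (A ⊗ M) M) (rho' : chom (A ⊗ N) N)
    (f : chom B (A ⊗ A)) (g : chom B' B) :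
  act2 rho rho' f ∘ (g ⊗ₘ idm (M ⊗ N)) = act2 rho rho' (f ∘ g).
Proof. by rewrite /act2 -!compA comp_tens comp1m. Qed.

Lemma act2_tensm (B B' M N : C) (rho : chom (A ⊗ M) M) (rho' : chom (A ⊗ N) N)
    (f : chom B A) (g : chom B' A) :
  act2 rho rho' (f ⊗ₘ g) =
  ((rho ∘ (f ⊗ₘ idm M)) ⊗ₘ (rho' ∘ (g ⊗ₘ idm N))) ∘ mid B B' M N.
Proof. by rewrite /act2 -tens1 -compA mid_nat compA comp_tens. Qed.

Variable H : chom L A.

Definition prim := (H ⊗ₘ eta) ∘ runiti L + (eta ⊗ₘ H) ∘ luniti L.

(** Since [eta] acts trivially, each summand of [prim] acts through [H] on one tensor factor
    only. *)
Lemma act2_prim (M N : C) (rho : chom (A ⊗ M) M) (rho' : chom (A ⊗ N) N) :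
  is_module m eta rho -> is_module m eta rho' ->
  act2 rho rho' prim =
  boxplus (rho ∘ (H ⊗ₘ idm M)) (rho' ∘ (H ⊗ₘ idm N)).
Proof.
move=> rM rN; rewrite {1}/act2 /prim tens_addl comp_addr; congr (_ + _).
- rewrite -/(act2 _ _ _) -act2_comp act2_tensm (module1 rN).
  rewrite -mid_unit2 !compA comp_tens.
  by rewrite compm1 comp1m.
- rewrite -/(act2 _ _ _) -act2_comp act2_tensm (module1 rM).
  rewrite -compA -(compA _ (braid _ _ ⊗ₘ _)) -(compA _ (asc _ _ _)).
  rewrite (compA (asc _ _ _)) -mid_unit1 !compA comp_tens.
  by rewrite compm1 comp1m.
Qed.

(** The right unit law of [m] removes each [eta], and the remaining [mid] is trivial by
    [mid_units]. *)
Lemma act2_regular (B : C) (f : chom B (A ⊗ A)) :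
  is_monoid m eta ->
  act2 m m f ∘ (idm B ⊗ₘ ((eta ⊗ₘ eta) ∘ luniti (uob C))) ∘ runiti B = f.
Proof.
move=> mA; rewrite /act2.
have := mid_units A A; have := mid_nat (idm A) (idm A) eta eta.
move: (mid A A (uob C) (uob C)) (mid A A A A) => t s nat units.
rewrite -!compA (compA (f ⊗ₘ _)) comp_tens compm1 comp1m.
have -> : f ⊗ₘ ((eta ⊗ₘ eta) ∘ luniti (uob C)) =
    (idm A ⊗ₘ idm A ⊗ₘ (eta ⊗ₘ eta)) ∘ (idm (A ⊗ A) ⊗ₘ luniti (uob C))
      ∘ (f ⊗ₘ idm (uob C)).
  by rewrite !comp_tens tens1 !comp1m compm1.
rewrite -!compA runiti_nat !compA -(compA _ s) nat !compA comp_tens.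
by rewrite !(monoid1r mA) units idtoVK comp1m.
Qed.

(** Applying [eps] to the left factor of [Delta ∘ H] yields [H = eta ∘ eps ∘ H + H]. Cancel [H],
    then compose with [eps], using [eps ∘ eta = id]. *)
Lemma counit_prim (Delta : chom A (A ⊗ A)) (eps : chom A (uob C)) :
  is_bimonoid m eta Delta eps -> Delta ∘ H = prim -> eps ∘ H = 0.
Proof.
move=> bA HD; have eE := counit1 bA.
have : lunit A ∘ (eps ⊗ₘ idm A) ∘ Delta ∘ H = H.
  by rewrite (comonoid1l bA) comp1m.
rewrite -compA HD /prim comp_addr !compA.
rewrite -!(compA (lunit A) (eps ⊗ₘ _)) !comp_tens !comp1m eE.
rewrite lunit_nat -(compA H) idtoVK compm1.
rewrite -[RHS]add0r => /addIr.
have -> : (eps ∘ H) ⊗ₘ eta = (idm (uob C) ⊗ₘ eta) ∘ ((eps ∘ H) ⊗ₘ idm (uob C)).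
  by rewrite comp_tens comp1m compm1.
rewrite compA lunit_nat -!compA runiti_nat => E.
have := congr1 (mcomp eps) E; rewrite comp0r !compA eE comp1m.
by rewrite idto_comp (idto_irr _ erefl) comp1m.
Qed.

Lemma boxplusD (M N : C) (g h : chom (L ⊗ M) M) (g' h' : chom (L ⊗ N) N) :
  boxplus (g + h) (g' + h') = boxplus g g' + boxplus h h'.
Proof.
rewrite /boxplus tens_addl tens_addr !comp_addl.
exact: addrACA.
Qed.

End TwoSidedAction.

(** * Equality of weak modules and of their morphisms *)

Section Equalities.
Variables (K : pzRingType) (C : ssm_linear_category K).
Variable X : lie_rinehart C.

(** Equal weak modules have actions that agree up to transport along an equality of carriers; here
    it equates [M] with itself, so the transport is the identity. *)
Lemma wm_lie_inj (M : C) (rho : chom (lrA X ⊗ M) M) (g g' : chom (lrL X ⊗ M) M)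
    (ax : is_weak_module rho g) (ax' : is_weak_module rho g') :
  WeakModule ax = WeakModule ax' -> g = g'.
Proof.
have tr (N P : weak_module X) : N = P -> exists e : wm_ob N = wm_ob P,
    idto e ∘ wm_lie N = wm_lie P ∘ (idm _ ⊗ₘ idto e).
  by move=> ->; exists erefl; rewrite idto1 tens1 comp1m compm1.
case/tr => /= e; rewrite (@idto_irr C _ _ e erefl) idto1 tens1.
by rewrite comp1m compm1.
Qed.

Lemma eq_weak_module (M : C) (rho : chom (lrA X ⊗ M) M)
    (g g' : chom (lrL X ⊗ M) M)
    (ax : is_weak_module rho g) (ax' : is_weak_module rho g') :
  g = g' -> WeakModule ax = WeakModule ax'.
Proof. by move=> E; case: g' / E ax' => ax'; congr WeakModule. Qed.

Lemma eq_wm_arrow (M M' N N' : WMod X) (f : chom M N) (f' : chom M' N') :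
  M = M' -> N = N' -> Arrow (sval f) = Arrow (sval f') -> Arrow f = Arrow f'.
Proof.
move=> eM eN; case: M' / eM f' => f'; case: N' / eN f' => f' /Arrow_inj E.
by congr Arrow; apply: wm_hom_inj.
Qed.

Lemma regular_weak_module : is_weak_module (lr_mul X) (lr_anchor X).
Proof.
split; [|exact: lr_anchor_lie | exact: lr_derivation].
by split; [exact: monoidA (lr_monoid X) | exact: monoid1l (lr_monoid X)].
Qed.

Definition regular : weak_module X := WeakModule regular_weak_module.

End Equalities.

Theorem theorem3p27 (R : realType) (C : ssm_linear_category R[i])
    (X : lie_rinehart C)
    (Delta : chom (lrA X) (lrA X ⊗ lrA X)) (eps : chom (lrA X) (uob C))
    (bimonoidA : is_bimonoid (lr_mul X) (lr_unit X) Delta eps)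
    (closed : wm_tensor_closed Delta eps)
    (WMod_strict : is_strict_monoidal (WMod_monoidal closed))
    (H : chom (lrL X) (lrA X))
    (H_brk : H ∘ lr_brk X =
      lr_anchor X ∘ (idm (lrL X) ⊗ₘ H)
      - lr_anchor X ∘ (idm (lrL X) ⊗ₘ H) ∘ braid (lrL X) (lrL X)) :
  is_strict_monoidal_functor (WMod_monoidal closed) (WMod_monoidal closed)
    (twist_functor H_brk)
  <->
  Delta ∘ H =
    (H ⊗ₘ lr_unit X) ∘ runiti (lrL X) + (lr_unit X ⊗ₘ H) ∘ luniti (lrL X).
Proof.
rewrite -/(prim H); split=> [[_ smo _] | HD].
  have /wm_lie_inj := smo (regular X) (regular X).
  (* Both sides contain the [boxplus] of the two anchors; cancelling it leaves only the terms in
     [H]. *)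
  rewrite /twist boxplusD => /addrI.
  have mA := bimonoid_monoid bimonoidA.
  have rA := weak_module_module (regular_weak_module X).
  rewrite -(act2_prim H rA rA) -/(act2 _ _ _) act2_comp => E.
  by rewrite -[LHS](act2_regular _ mA) E act2_regular.
have eH := counit_prim bimonoidA HD.
have smo (V W : WMod X) : wm_twist H_brk (wm_tensor closed V W) =
    wm_tensor closed (wm_twist H_brk V) (wm_twist H_brk W).
  apply: eq_weak_module; rewrite /= /twist boxplusD; congr (_ + _).
  have rV := weak_module_module (wm_axioms V).
  have rW := weak_module_module (wm_axioms W).
  by rewrite -/(act2 _ _ _) act2_comp HD act2_prim.
split=> [|//|V V' W W' f g].
(* The twisted L-action on the unit object is [eps ∘ H] up to [runit]. *)
- apply: eq_weak_module; rewrite /= /twist add0r -compA runit_nat compA eH.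
  by rewrite comp0l.
(* The underlying morphisms already coincide; only sources and targets have to be identified. *)
- by apply: eq_wm_arrow => //; exact: smo.
Qed.
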